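(* Suppose that the linear regularity condition holds: there is $\kappa\in(0,\infty)$ with $$\mathrm{dist}_{\mathcal{X}}^2(x)\le\kappa\,\mathbf{E}[\mathrm{dist}_{\mathcal{X}_S}^2(x)]\qquad\text{for all }x\in\mathbb{R}^n.$$ Then $$\frac{1}{2\kappa}\|x-\Pi_{\mathcal{X}}(x)\|^2\le F(x)-F^*\le\frac{\gamma}{2}\|x-\Pi_{\mathcal{X}}(x)\|^2\qquad\text{for all }x\in\mathbb{R}^n,$$ and $$\frac{1}{2\gamma}\|\nabla F(x)\|^2\le F(x)-F^*\le\frac{\kappa}{2}\|\nabla F(x)\|^2\qquad\text{for all }x\in\mathbb{R}^n.$$
   Context: $\mathcal{X}\subseteq\mathbb{R}^n$ is a nonempty closed convex set and $(\Omega,\mathbf{P})$ is a probability space with random variable $S\sim\mathbf{P}$. For every $S\in\Omega$, $\mathcal{X}_S$ is a random closed convex subset of $\mathbb{R}^n$ with $\mathcal{X}\subseteq\mathcal{X}_S$; as part of ''random set'', $S\mapsto\Pi_{\mathcal{X}_S}(x)$ is measurable for each $x$. $\Pi_C$ is the Euclidean projection onto $C$, $\mathrm{dist}_C$ the Euclidean distance to $C$, and $\mathbf{E}$ the expectation over $S\sim\mathbf{P}$. The function $F$ is $F(x)=\frac12\mathbf{E}[\|x-\Pi_{\mathcal{X}_S}(x)\|^2]$, with gradient $\nabla F(x)=\mathbf{E}[x-\Pi_{\mathcal{X}_S}(x)]$, and $F^*=\min_{x}F(x)=0$. The constant $\gamma\ge0$ is the smallest constant such that $\|\mathbf{E}[x-\Pi_{\mathcal{X}_S}(x)]\|^2\le\gamma\,\mathbf{E}[\|x-\Pi_{\mathcal{X}_S}(x)\|^2]$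 for all $x\in\mathbb{R}^n$ (by Jensen, $\gamma\le1$). In the degenerate case $\gamma=0$ (where $\nabla F\equiv0$) the term $\frac{1}{2\gamma}\|\nabla F(x)\|^2$ is read as $0$. *)

(* Defs.v *)
From mathcomp Require Import all_boot all_order all_algebra.
From mathcomp Require Import all_classical all_reals all_analysis.
Set Implicit Arguments.
Unset Strict Implicit.
Unset Printing Implicit Defensive.
Import Order.TTheory GRing.Theory Num.Theory.
Import numFieldNormedType.Exports.
Local Open Scope classical_set_scope.
Local Open Scope ring_scope.

(* The library norm on 'rV[R]_n is the sup norm; the Euclidean one is needed.
   Both induce the same topology, so the library's [closed] is unaffected. *)
Definition enorm (R : realType) (n : nat) (x : 'rV[R]_n) : R :=
  Num.sqrt (\sum_(i < n) (x 0 i) ^+ 2).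

Definition eucl_dist (R : realType) (n : nat) (C : set 'rV[R]_n) (x : 'rV[R]_n) : R :=
  inf [set enorm (x - y) | y in C].

(* A nearest point of C to x; it exists and is unique when C is nonempty,
   closed and convex, the only case in which the value is meaningful. *)
Definition eproj (R : realType) (n : nat) (C : set 'rV[R]_n) (x : 'rV[R]_n) :
    'rV[R]_n :=
  xget 0 [set y | C y /\ forall z, C z -> enorm (x - y) <= enorm (x - z)].

Definition grad (R : realType) (n : nat) (f : 'rV[R]_n -> R) (x : 'rV[R]_n) :
    'rV[R]_n :=
  \row_(i < n) 'D_(delta_mx 0 i) (f : 'rV[R]_n -> R^o) x.

Section RandomSet.
Context (R : realType) (n : nat) (d : measure_display)
  (Omega : measurableType d) (P : probability Omega R).
Implicit Types (XS : Omega -> set 'rV[R]_n) (x : 'rV[R]_n).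

(* Real-valued expectation. [fine] sends infinite values to 0, but when
   S |-> eproj (XS S) x is measurable and all the XS S contain a common point y,
   enorm (x - eproj (XS S) x) <= enorm (x - y), so every expectation formed
   below is finite. *)
Definition Exp (f : Omega -> R) : R := fine ('E_P[f])%E.

Definition vExp (f : Omega -> 'rV[R]_n) : 'rV[R]_n :=
  \row_(i < n) Exp (fun S => f S 0 i).

Definition half_msd XS x : R :=
  2^-1 * Exp (fun S => enorm (x - eproj (XS S) x) ^+ 2).

Definition half_msd_min XS : R := inf (range (half_msd XS)).

Definition gamma_bounds XS : set R :=
  [set g | 0 <= g /\ forall x,
     enorm (vExp (fun S => x - eproj (XS S) x)) ^+ 2
       <= g * Exp (fun S => enorm (x - eproj (XS S) x) ^+ 2)].

Definition is_smallest_gamma XS (gamma : R) : Prop :=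
  gamma_bounds XS gamma /\ lbound (gamma_bounds XS) gamma.

Definition linear_regularity (X : set 'rV[R]_n) XS (kappa : R) : Prop :=
  forall x, eucl_dist X x ^+ 2 <= kappa * Exp (fun S => eucl_dist (XS S) x ^+ 2).

End RandomSet.

(* Main.v *)
(* Write r_S x = x - Pi_{X_S} x, g = E[r_S x] and M = E[|r_S x|^2], so that
   F x = M / 2.  The obtuse-angle inequality for Pi_{X_S} gives
   0 <= |r_S (x + h)|^2 - |r_S x|^2 - 2 <r_S x, h> <= |h|^2; taking expectations,
   F is differentiable with gradient g.  The same inequality at z = Pi_X x, a
   point of every X_S, gives |r_S x|^2 <= <r_S x, x - z>, hence
   M <= <g, x - z>.  Young's inequality then yields M <= gamma |x - z|^2 from
   |g|^2 <= gamma M, and M <= kappa |g|^2 from |x - z|^2 <= kappa M. *)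
Require Import Defs.
From mathcomp Require Import all_boot all_order all_algebra.
From mathcomp Require Import all_classical all_reals all_analysis.
From mathcomp Require Import ring lra.
Import Order.TTheory GRing.Theory Num.Theory.
Import numFieldNormedType.Exports.
Local Open Scope classical_set_scope.
Local Open Scope ring_scope.

(** * Euclidean inner product and norm on row vectors *)

Section Dot.
Context {R : realType} {n : nat}.
Implicit Types (u v w : 'rV[R]_n) (a : R).

Definition dot u v : R := \sum_(i < n) u 0 i * v 0 i.

Lemma dotC u v : dot u v = dot v u.
Proof. by apply: eq_bigr => i _; rewrite mulrC. Qed.

Lemma dotDl u v w : dot (u + v) w = dot u w + dot v w.
Proof. by rewrite -big_split; apply: eq_bigr => i _; rewrite mxE mulrDl. Qed.

Lemma dotZl a u v : dot (a *: u) v = a * dot u v.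
Proof. by rewrite mulr_sumr; apply: eq_bigr => i _; rewrite mxE mulrA. Qed.

Lemma dotNl u v : dot (- u) v = - dot u v.
Proof. by rewrite -scaleN1r dotZl mulN1r. Qed.

Lemma dotDr u v w : dot u (v + w) = dot u v + dot u w.
Proof. by rewrite !(dotC u) dotDl. Qed.

Lemma dotZr a u v : dot u (a *: v) = a * dot u v.
Proof. by rewrite !(dotC u) dotZl. Qed.

Lemma dotNr u v : dot u (- v) = - dot u v.
Proof. by rewrite !(dotC u) dotNl. Qed.

Definition dotE := (dotDl, dotDr, dotNl, dotNr, dotZl, dotZr).

Lemma dot_ge0 u : 0 <= dot u u.
Proof. by apply: sumr_ge0 => i _; rewrite -expr2 sqr_ge0. Qed.

Lemma dot_delta u i : dot u (delta_mx 0 i) = u 0 i.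
Proof.
rewrite /dot (bigD1 i) //= mxE !eqxx mulr1 big1 ?addr0 // => j ji.
by rewrite mxE (negbTE ji) andbF mulr0.
Qed.

(** A sum of squares vanishes only if every coordinate does. This serves the degenerate case
    [gamma = 0]. *)
Lemma dot_eq0 u v : dot u u = 0 -> dot u v = 0.
Proof.
move=> /eqP; rewrite psumr_eq0; last by move=> i _; rewrite -expr2 sqr_ge0.
move=> /allP u0; apply: big1 => i _.
by have := u0 i (mem_index_enum i); rewrite mulf_eq0 orbb => /eqP ->; rewrite mul0r.
Qed.

(** Expand [0 <= dot (a *: u - v) (a *: u - v)] and divide by [a]. *)
Lemma dot_young a u v : 0 < a -> 2 * dot u v <= a * dot u u + a^-1 * dot v v.
Proof.
move=> a0; rewrite -(ler_pM2l a0) mulrDr mulVKf ?gt_eqF //.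
have := dot_ge0 (a *: u - v); rewrite !dotE (dotC v u); lra.
Qed.

Lemma sqr_coord_le_dot u i : (u 0 i) ^+ 2 <= dot u u.
Proof.
rewrite /dot (bigD1 i) //= -expr2 lerDl.
by apply: sumr_ge0 => j _; rewrite -expr2 sqr_ge0.
Qed.

Lemma sqr_enorm u : enorm u ^+ 2 = dot u u.
Proof. by rewrite sqr_sqrtr ?sumr_ge0 // => i _; rewrite sqr_ge0. Qed.

Lemma enorm_ge0 u : 0 <= enorm u.
Proof. exact: sqrtr_ge0. Qed.

Lemma ler_enorm u v : (enorm u <= enorm v) = (dot u u <= dot v v).
Proof. by rewrite -!sqr_enorm ler_sqr // nnegrE enorm_ge0. Qed.

Lemma normr_coord_le_enorm u i : `|u 0 i| <= enorm u.
Proof.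
by rewrite -ler_sqr ?nnegrE ?enorm_ge0 // sqr_enorm real_normK ?num_real
  ?sqr_coord_le_dot.
Qed.

(** Comparison of the sup norm with the Euclidean one; it turns Euclidean bounds into boundedness in
    the sense of the library. *)
Lemma normr_le_enorm u : `|u| <= enorm u.
Proof.
rewrite [`|u|]mx_normrE; apply/bigmax_leP; split => [|ij _]; first exact: enorm_ge0.
by rewrite [ij.1]ord1 normr_coord_le_enorm.
Qed.

Lemma dist2_continuous u : continuous (fun v => dot (u - v) (u - v)).
Proof.
have dist2E v : dot (u - v) (u - v) = \sum_(i < n) (u 0 i - v 0 i) ^+ 2.
  by apply: eq_bigr => i _; rewrite !mxE expr2.
rewrite (_ : (fun _ => _) = fun v => \sum_(i < n) (u 0 i - v 0 i) ^+ 2); last exact/funext.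
apply: continuous_big => [|i _ v]; first exact: add_continuous.
have c : u 0 i - w 0 i @[w --> v] --> u 0 i - v 0 i.
  by apply: cvgB; [exact: cvg_cst | exact: (@coord_continuous _ _ _ 0 i v)].
exact: (cvgM c c).
Qed.

End Dot.

(** * Projection onto a closed convex set: existence, obtuse angle, expansion of the squared
    distance *)

Section Projection.
Context {R : realType} {n : nat} (C : set 'rV[R]_n).
Hypotheses (C_neq0 : C !=set0) (C_closed : closed C).
Implicit Types x y z h : 'rV[R]_n.

(** Only points of [C] at least as close to [x] as some fixed [y0] in [C] compete. They form a
    compact set, on which the continuous squared distance attains its minimum. *)
Lemma nearest_point_exists x :
  exists y, C y /\ forall z, C z -> enorm (x - y) <= enorm (x - z).
Proof.
have [y0 Cy0] := C_neq0.
pose A := C `&` [set y | dot (x - y) (x - y) <= dot (x - y0) (x - y0)].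
have A_closed : closed A.
  apply: closedI => //.
  apply: (closed_comp _ (@closed_le _ (dot (x - y0) (x - y0)))) => y _.
  exact: dist2_continuous.
have A_bounded : bounded_set A.
  (* The radius comes from writing [y = x - (x - y)]. *)
  exists (`|x| + enorm (x - y0)); split; first exact: num_real.
  move=> M ltM y [_] /=; rewrite -ler_enorm => le_y.
  apply: le_trans (ltW ltM); rewrite -[y](subKr x).
  apply: (le_trans (ler_normB _ _)); rewrite lerD2l.
  exact: le_trans (normr_le_enorm _) le_y.
have [|||y yA ymin] := @EVT_min_rV _ _ (fun y => dot (x - y) (x - y)) A.
- by exists y0; split => //=.
- exact: bounded_closed_compact.
- exact/continuous_subspaceT/dist2_continuous.
exists y; have [Cy /= le_y] := set_mem yA; split=> // z Cz; rewrite ler_enorm.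
have [le_z|/ltW le_z] := leP (dot (x - z) (x - z)) (dot (x - y0) (x - y0)).
  by apply: ymin; apply/mem_set.
exact: le_trans le_y le_z.
Qed.

Lemma eprojP x :
  C (eproj C x) /\ forall z, C z -> enorm (x - eproj C x) <= enorm (x - z).
Proof. exact: (xgetPex 0 (nearest_point_exists x)). Qed.

Lemma eucl_distE x : eucl_dist C x = enorm (x - eproj C x).
Proof.
have [Cp p_min] := eprojP x.
apply/eqP; rewrite eq_le; apply/andP; split.
  apply: ge_inf; last by exists (eproj C x).
  by exists 0 => _ [y _ <-]; exact: enorm_ge0.
apply: lb_le_inf; first by exists (enorm (x - eproj C x)), (eproj C x).
by move=> _ [y Cy <-]; exact: p_min.
Qed.

Hypothesis C_convex : convex_set C.

(** First-order optimality: by convexity the segment from the projection to [z] stays in [C], and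
    moving along it cannot bring the point closer to [x]. *)
Lemma eproj_obtuse x z : C z -> dot (x - eproj C x) (z - eproj C x) <= 0.
Proof.
move=> Cz; have [Cp p_min] := eprojP x; set p := eproj C x in Cp p_min *.
have opt t : 0 <= t <= 1 -> 2 * t * dot (x - p) (z - p) <= t ^+ 2 * dot (z - p) (z - p).
  move=> /andP[t0 t1].
  have Cq : C (t *: z + (1 - t) *: p).
    have := C_convex z p (Itv01 t0 t1) (mem_set Cz) (mem_set Cp).
    by rewrite inE.
  have := p_min _ Cq; rewrite ler_enorm.
  have -> : x - (t *: z + (1 - t) *: p) = (x - p) - t *: (z - p).
    by apply/rowP => i; rewrite !mxE; ring.
  move: (x - p) (z - p) => u w; rewrite !dotE (dotC w u); lra.
rewrite leNgt; apply/negP; move: (x - p) (z - p) opt => u w opt.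
set a := dot _ _ => a0; set b := dot w w; have b0 : 0 <= b := dot_ge0 _.
have ab0 : 0 < a + b by rewrite ltr_wpDr.
(* If [a > 0], the parameter [t = a / (a + b)] lies in (0, 1], even when [b = 0], and satisfies
   [t * b <= a]. Then [opt] gives [2 * a <= t * b <= a], a contradiction. *)
have t0 : 0 < a / (a + b) by rewrite divr_gt0.
have tb : a / (a + b) * b <= a by rewrite mulrAC ler_pdivrMr // ler_pM2l // lerDr ltW.
have t1 : a / (a + b) <= 1 by rewrite ler_pdivrMr // mul1r lerDl.
have := opt (a / (a + b)); rewrite t1 ltW // => /(_ isT); rewrite -/a -/b.
have -> : 2 * (a / (a + b)) * a <= (a / (a + b)) ^+ 2 * b = (2 * a <= a / (a + b) * b).
  by rewrite expr2 -mulrA mulrCA -(mulrA (_ / _)) ler_pM2l.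
lra.
Qed.

Lemma sqr_resid_le x y : C y ->
  dot (x - eproj C x) (x - eproj C x) <= dot (x - eproj C x) (x - y).
Proof.
move=> Cy; have := eproj_obtuse x y Cy; set p := eproj C x.
have -> : y - p = (x - p) - (x - y) by apply/rowP => i; rewrite !mxE; ring.
by rewrite dotDr dotNr subr_le0.
Qed.

(** Upper bound: [eproj C x] competes with the nearest point of [x + h]. Lower bound: the obtuse
    angle at [x], tested on [eproj C (x + h)]. *)
Lemma sqr_resid_expansion x h (r := fun y => y - eproj C y) :
  0 <= dot (r (x + h)) (r (x + h)) - dot (r x) (r x) - 2 * dot (r x) h <= dot h h.
Proof.
rewrite /r; have [Cp _] := eprojP x; have [Cq q_min] := eprojP (x + h).
have := q_min _ Cp; have := eproj_obtuse x _ Cq; rewrite ler_enorm.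
set p := eproj C x; set q := eproj C (x + h).
have -> : x + h - p = (x - p) + h by apply/rowP => i; rewrite !mxE; ring.
have -> : x + h - q = (x - p) + (h - (q - p)).
  by apply/rowP => i; rewrite !mxE; ring.
move: (x - p) (q - p) => u w obt upper; apply/andP; split; last first.
  by move: upper; rewrite !(dotDl u h, dotDr _ u h) (dotC h u); lra.
have uhw : dot u (h - w) = dot u h - dot u w by rewrite dotDr dotNr.
(* convexity of the squared distance: |u + k|^2 >= |u|^2 + 2 <u, k>, and <u, w> <= 0 *)
have := dot_ge0 (h - w); move: (h - w) uhw => k uk.
by rewrite !(dotDl u k, dotDr _ u k) (dotC k u); lra.
Qed.

End Projection.

(** After division by [h], the difference quotient is within [K * |h|] of [c]. *)
Lemma derive_of_quadratic_error (R : realType) (V : normedModType R) (f : V -> R^o)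
    (x v : V) (c K : R) :
  (forall h : R, `|f (h *: v + x) - f x - h * c| <= K * h ^+ 2) -> 'D_v f x = c.
Proof.
move=> f_err; apply: cvg_lim => //; apply/cvgrPdist_le => e e0.
(* Nothing is assumed on [K]; the added 1 keeps the denominator positive. *)
have eK : 0 < e / (`|K| + 1) by rewrite divr_gt0 // ltr_wpDl.
near=> h.
have h0 : h != 0 by near: h; exact: nbhs_dnbhs_neq.
have he : `|h| <= e / (`|K| + 1) by near: h; exact: dnbhs0_le.
rewrite -(ler_pM2l (_ : 0 < `|h|)) ?normr_gt0 // -normrM.
have -> : h * (c - h^-1 *: ((f \o shift x) (h *: v) - f x)) = - (f (h *: v + x) - f x - h * c).
  by rewrite /= /GRing.scale /= mulrBr mulVKf //; ring.
rewrite normrN (le_trans (f_err h)) // -real_normK ?num_real // expr2 mulrCA.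
rewrite ler_pM2l ?normr_gt0 //.
move: he; rewrite ler_pdivlMr ?ltr_wpDl // => he.
have := ler_norm K; have := normr_ge0 h; nra.
Unshelve. all: by end_near.
Qed.

(** * Linearity of the real-valued expectation and integrability of bounded functions *)

Section Expectation.
Context {d : measure_display} {T : measurableType d} {R : realType}.
Variable P : probability T R.
Implicit Types f g : T -> R.

Lemma ExpE f : Exp P f = Rintegral P setT f.
Proof. by rewrite /Exp /Rintegral unlock. Qed.

Lemma Exp_ge0 f : (forall t, 0 <= f t) -> 0 <= Exp P f.
Proof. by move=> f0; rewrite ExpE; apply: Rintegral_ge0. Qed.

(** Both claims go through one induction, since additivity of the integral needs the tail sum to be
    integrable. *)
Lemma integrable_Exp_sum (I : Type) (s : seq I) (f : I -> T -> R) :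
  (forall i, P.-integrable setT (EFin \o f i)) ->
  P.-integrable setT (EFin \o fun t => \sum_(i <- s) f i t) /\
  Exp P (fun t => \sum_(i <- s) f i t) = \sum_(i <- s) Exp P (f i).
Proof.
move=> f_int; elim: s => [|i s [IH_int IH]].
  rewrite (_ : (fun _ => _) = cst 0); last by apply/funext => t; rewrite big_nil.
  by rewrite big_nil ExpE Rintegral_cst // mul0r; split=> //; exact: integrable0.
rewrite (_ : (fun _ => _) = fun t => f i t + \sum_(j <- s) f j t); last first.
  by apply/funext => t; rewrite big_cons.
rewrite big_cons -IH !ExpE RintegralD //; split=> //.
exact: (@integrableD _ _ _ _ _ _ (EFin \o f i) (EFin \o fun t => \sum_(j <- s) f j t)).
Qed.

Lemma integrable_Exp_dot n (f : T -> 'rV[R]_n) (v : 'rV[R]_n) :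
  (forall i, P.-integrable setT (EFin \o fun t => f t 0 i)) ->
  P.-integrable setT (EFin \o fun t => dot (f t) v) /\
  Exp P (fun t => dot (f t) v) = dot (vExp P f) v.
Proof.
move=> f_int.
have [|int_s ->] := @integrable_Exp_sum _ (index_enum 'I_n) (fun i t => f t 0 i * v 0 i).
  by move=> i; exact: (integrableZr _ (v 0 i) (f_int i)).
by split=> //; apply: eq_bigr => i _; rewrite mxE !ExpE RintegralZr.
Qed.

Lemma bounded_integrable f (K : R) :
  measurable_fun setT f -> (forall t, `|f t| <= K) -> P.-integrable setT (EFin \o f).
Proof.
move=> mf fK; apply: measurable_bounded_integrable => //.
  by rewrite (le_lt_trans (probability_le1 P _)) // ltry.
by exists K; split=> [|M /ltW KM t _]; [exact: num_real | exact: le_trans (fK t) KM].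
Qed.

End Expectation.

(** * Mean residuals of random projections, and the gradient and minimum of [half_msd] *)

Section RandomProjection.
Context {R : realType} {n : nat} {d : measure_display} {Omega : measurableType d}.
Variables (P : probability Omega R) (XS : Omega -> set 'rV[R]_n) (y : 'rV[R]_n).
Hypotheses (XS_closed : forall S, closed (XS S))
  (XS_convex : forall S, convex_set (XS S)) (XS_y : forall S, XS S y)
  (XS_random : forall (x : 'rV[R]_n) (i : 'I_n),
     measurable_fun [set: Omega] (fun S => eproj (XS S) x 0 i)).
Implicit Types x h : 'rV[R]_n.

Definition resid x S : 'rV[R]_n := x - eproj (XS S) x.

Definition mean_resid x : 'rV[R]_n := vExp P (resid x).

Definition mean_sqr_resid x : R := Exp P (fun S => dot (resid x S) (resid x S)).

Let XS_neq0 S : XS S !=set0. Proof. by exists y. Qed.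

Lemma measurable_resid x i : measurable_fun setT (fun S => resid x S 0 i).
Proof.
rewrite (_ : (fun _ => _) = fun S => x 0 i - eproj (XS S) x 0 i); last first.
  by apply/funext => S; rewrite !mxE.
exact: measurable_realfun.measurable_funB.
Qed.

(** The common point [y] competes in every [XS S]. The bound does not depend on [S], which makes
    residuals and their squares integrable. *)
Lemma enorm_resid_le x S : enorm (resid x S) <= enorm (x - y).
Proof. by have [_] := eprojP _ (XS_neq0 S) (XS_closed S) x; apply. Qed.

Lemma integrable_resid x i : P.-integrable setT (EFin \o fun S => resid x S 0 i).
Proof.
apply: (bounded_integrable _ _ (enorm (x - y))) => [|S].
  exact: measurable_resid.
exact: le_trans (normr_coord_le_enorm _ _) (enorm_resid_le x S).
Qed.

Lemma integrable_sqr_resid x :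
  P.-integrable setT (EFin \o fun S => dot (resid x S) (resid x S)).
Proof.
apply: (bounded_integrable _ _ (dot (x - y) (x - y))) => [|S].
  by apply: measurable_sum => i; apply: measurable_realfun.measurable_funM; exact: measurable_resid.
by rewrite ger0_norm ?dot_ge0 // -ler_enorm enorm_resid_le.
Qed.

Lemma mean_sqr_resid_ge0 x : 0 <= mean_sqr_resid x.
Proof. by apply: Exp_ge0 => S; exact: dot_ge0. Qed.

Lemma half_msdE x : half_msd P XS x = 2^-1 * mean_sqr_resid x.
Proof.
by rewrite /half_msd; congr (_ * Exp P _); apply/funext => S; rewrite sqr_enorm.
Qed.

(** Average [sqr_resid_le] over [S]: as [z] is the same for all [S], the vector [x - z] comes out of
    the expectation. *)
Lemma mean_sqr_resid_le x z : (forall S, XS S z) ->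
  mean_sqr_resid x <= dot (mean_resid x) (x - z).
Proof.
move=> XS_z.
have [int_dot <-] := integrable_Exp_dot P n (resid x) (x - z) (integrable_resid x).
rewrite /mean_sqr_resid !ExpE; apply: le_Rintegral => // [|S _].
  exact: integrable_sqr_resid.
exact: sqr_resid_le.
Qed.

(** The nonnegative function [half_msd] vanishes at the common point [y], by [mean_sqr_resid_le]
    with [x = z = y]. *)
Lemma half_msd_minE : half_msd_min P XS = 0.
Proof.
have F0 x : 0 <= half_msd P XS x by rewrite half_msdE mulr_ge0 ?mean_sqr_resid_ge0.
have Fy : half_msd P XS y = 0.
  apply/eqP; rewrite eq_le F0 half_msdE pmulr_rle0 ?invr_gt0 // andbT.
  apply: (le_trans (mean_sqr_resid_le y y XS_y)).
  by rewrite subrr -(scale0r 0) dotZr mul0r.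
apply/eqP; rewrite eq_le; apply/andP; split.
  rewrite -Fy; apply: ge_inf; last by exists y.
  by exists 0 => _ [x _ <-].
apply: lb_le_inf; first by exists (half_msd P XS y), y.
by move=> _ [x _ <-].
Qed.

(** Half the expectation of [sqr_resid_expansion]: the error lies between 0 and half of
    [dot h h]. *)
Lemma half_msd_expansion x h :
  `|half_msd P XS (x + h) - half_msd P XS x - dot (mean_resid x) h|
    <= 2^-1 * dot h h.
Proof.
have [int_dot Exp_dot] := integrable_Exp_dot P n (resid x) h (integrable_resid x).
have int0 := integrable_sqr_resid x; have int1 := integrable_sqr_resid (x + h).
have intZ := integrableZl measurableT 2 int_dot.
have intB := integrableB measurableT int1 int0.
have intBB := integrableB measurableT intB intZ.
have expansion S := sqr_resid_expansion _ (XS_neq0 S) (XS_closed S) (XS_convex S) x h.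
have ME : mean_sqr_resid (x + h) - mean_sqr_resid x - 2 * dot (mean_resid x) h =
    Rintegral P setT (fun S => dot (resid (x + h) S) (resid (x + h) S)
      - dot (resid x S) (resid x S) - 2 * dot (resid x S) h).
  by rewrite !RintegralB // RintegralZl // -!ExpE Exp_dot.
have lower : 0 <= mean_sqr_resid (x + h) - mean_sqr_resid x - 2 * dot (mean_resid x) h.
  by rewrite ME; apply: Rintegral_ge0 => S _; have /andP[] := expansion S.
have upper : mean_sqr_resid (x + h) - mean_sqr_resid x - 2 * dot (mean_resid x) h <= dot h h.
  (* The total mass of [P] is 1, so a constant is its own integral. *)
  have -> : dot h h = Rintegral P setT (fun=> dot h h).
    rewrite Rintegral_cst // -[LHS]mulr1; congr (_ * _).
    exact: (congr1 fine (esym (probability_setT P))).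
  rewrite ME; apply: le_Rintegral => // [|S _]; last by have /andP[] := expansion S.
  exact: finite_measure_integrable_cst.
rewrite !half_msdE ger0_norm; lra.
Qed.

Lemma grad_half_msd x : grad (half_msd P XS) x = mean_resid x.
Proof.
apply/rowP => i; rewrite mxE -[RHS]dot_delta.
apply: (derive_of_quadratic_error _ 'rV[R]_n (half_msd P XS) x (delta_mx 0 i) _ 2^-1) => t.
have := half_msd_expansion x (t *: delta_mx 0 i).
by rewrite (addrC x) !(dotZr, dotZl) (dot_delta (delta_mx 0 i)) mxE !eqxx mulr1 -expr2.
Qed.

End RandomProjection.

(* For gamma = 0 the convention 0^-1 = 0 makes (2 * gamma)^-1 * _ equal to 0. *)
Theorem theorem3 (R : realType) (n : nat)
    (d : measure_display) (Omega : measurableType d) (P : probability Omega R)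
    (X : set 'rV[R]_n) (XS : Omega -> set 'rV[R]_n) (gamma kappa : R)
    (X_neq0 : X !=set0) (X_closed : closed X) (X_convex : convex_set X)
    (XS_closed : forall S, closed (XS S))
    (XS_convex : forall S, convex_set (XS S))
    (X_sub_XS : forall S, X `<=` XS S)
    (XS_random : forall (x : 'rV[R]_n) (i : 'I_n),
       measurable_fun [set: Omega] (fun S => eproj (XS S) x 0 i))
    (gammaP : is_smallest_gamma P XS gamma)
    (kappa_gt0 : 0 < kappa)
    (regular : linear_regularity P X XS kappa) :
  (forall x : 'rV[R]_n,
     (2 * kappa)^-1 * enorm (x - eproj X x) ^+ 2
       <= half_msd P XS x - half_msd_min P XS
     /\ half_msd P XS x - half_msd_min P XS
       <= gamma / 2 * enorm (x - eproj X x) ^+ 2)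
  /\
  (forall x : 'rV[R]_n,
     (2 * gamma)^-1 * enorm (grad (half_msd P XS) x) ^+ 2
       <= half_msd P XS x - half_msd_min P XS
     /\ half_msd P XS x - half_msd_min P XS
       <= kappa / 2 * enorm (grad (half_msd P XS) x) ^+ 2).
Proof.
have [y0 Xy0] := X_neq0.
have XS_X z : X z -> forall S, XS S z by move=> Xz S; exact: X_sub_XS.
have FE x : half_msd P XS x - half_msd_min P XS = 2^-1 * mean_sqr_resid P XS x.
  by rewrite (half_msd_minE P XS y0) ?subr0 ?half_msdE //; exact: XS_X.
have gradE x : grad (half_msd P XS) x = mean_resid P XS x.
  by apply: (grad_half_msd P XS y0) => //; exact: XS_X.
have MSE x : Exp P (fun S => enorm (x - eproj (XS S) x) ^+ 2) = mean_sqr_resid P XS x.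
  by congr (Exp P _); apply/funext => S; rewrite sqr_enorm.
have M_ge0 x := mean_sqr_resid_ge0 P XS x.
have [[gamma_ge0 gamma_bd] _] := gammaP.
have mean_bd x : dot (mean_resid P XS x) (mean_resid P XS x) <= gamma * mean_sqr_resid P XS x.
  by have := gamma_bd x; rewrite MSE sqr_enorm.
have reg x : dot (x - eproj X x) (x - eproj X x) <= kappa * mean_sqr_resid P XS x.
  have := regular x; rewrite eucl_distE // sqr_enorm.
  rewrite (_ : (fun S => _) = fun S => enorm (x - eproj (XS S) x) ^+ 2) ?MSE //.
  apply/funext => S; rewrite eucl_distE //; by exists y0; exact: XS_X.
have M_le x : mean_sqr_resid P XS x <= dot (mean_resid P XS x) (x - eproj X x).
  have [Xp _] := eprojP _ X_neq0 X_closed x.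
  by apply: (mean_sqr_resid_le P XS (eproj X x)) => //; exact: XS_X.
have mean_bdV x :
    gamma^-1 * dot (mean_resid P XS x) (mean_resid P XS x) <= mean_sqr_resid P XS x.
  (* With [0^-1 = 0] the left side is 0 when [gamma = 0]. *)
  have [->|gamma_neq0] := eqVneq gamma 0; first by rewrite invr0 mul0r.
  by rewrite mulrC ler_pdivrMr ?lt_neqAle ?gamma_ge0 1?eq_sym ?gamma_neq0 // mulrC.
have regV x : kappa^-1 * dot (x - eproj X x) (x - eproj X x) <= mean_sqr_resid P XS x.
  by rewrite mulrC ler_pdivrMr // mulrC.
have M_le_gamma x :
    mean_sqr_resid P XS x <= gamma * dot (x - eproj X x) (x - eproj X x).
  (* If [gamma = 0], the mean residual is zero, so [M_le] bounds the mean square by 0. *)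
  have := M_le x; have [gamma_eq0|gamma_neq0] := eqVneq gamma 0.
    have := mean_bd x; rewrite gamma_eq0 !mul0r => mean_le0.
    by rewrite dot_eq0 //; apply/eqP; rewrite eq_le mean_le0 dot_ge0.
  have gammaV_gt0 : 0 < gamma^-1 by rewrite invr_gt0 lt_neqAle eq_sym gamma_neq0.
  (* The weight [gamma^-1] makes the first Young term at most the mean square M, so
     [2 * M <= M + gamma * |x - eproj X x|^2]. *)
  have := dot_young _ (mean_resid P XS x) (x - eproj X x) gammaV_gt0.
  by rewrite invrK; have := mean_bdV x; lra.
split=> x; rewrite FE ?gradE !sqr_enorm ?invfM -?mulrA; split.
- by have := regV x; lra.
- by have := M_le_gamma x; lra.
- by have := mean_bdV x; lra.
(* With weight [kappa] it is the second Young term that [regV] bounds by the mean square and that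
   gets absorbed. *)
have := dot_young _ (mean_resid P XS x) (x - eproj X x) kappa_gt0.
by have := M_le x; have := regV x; lra.
Qed.
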